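(* Let $\mathcal{D}$ be a (possibly infinite) strong digraph. Then the infimum of $\ell(\gamma)\bigl(1-\lambda_S(\gamma)\bigr)$ taken over all proper cycles $\gamma$ of $\mathcal{D}$ is positive on $\mathcal{S}(\mathcal{D})$ if and only if $\mathcal{D}$ admits a finite cycle transversal: $$\inf_{\gamma\subset\mathcal{D}}\ \ell(\gamma)\bigl(1-\lambda_S(\gamma)\bigr)>0\quad \forall\, S\in\mathcal{S}(\mathcal{D})\iff |sct(\mathcal{D})|<\infty.$$
   Context: Digraphs have vertex-set $V(\mathcal{D})$ and arc-set $A(\mathcal{D})$, may be infinite, may have loops, but have no multiple arcs. A digraph is strong (strongly connected) if for any pair of distinct vertices $v,w$ there is a path from $v$ to $w$; each vertex of a strong digraph has at least one arc leaving it. A directed cycle is a finite strong digraph in which exactly one arc leaves each vertex (a loop is a cycle of length 1, an undirected edge, i.e. a pair of opposite arcs, is a cycle of length 2); ''cycle'' always means directed cycle, and $\ell(\gamma)$, the length of $\gamma$, is its number of arcs. A cycle $\gamma$ of $\mathcal{D}$ is proper, written $\gamma\subset\mathcal{D}$, if $\ell(\gamma)<|A(\mathcal{D})|$. A cycle transversal of $\mathcal{D}$ is a set of vertices whose removal (together with all incident arcs) leaves a digraph with no cycles; $|sct(\mathcal{D})|$ is the size of a smallest cycle transversal, and $|sct(\mathcal{D})|=\infty$ if there is no finite one. A weighting of $\mathcal{D}$ is a positive function on its arcs. It is substochastic if for each vertex the sum of the weights of the arcs leaving it (its out-weight) is not greater than $1$. $\mathcal{S}(\mathcal{D})$ is the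 class of all substochastic weightings of $\mathcal{D}$. For $S\in\mathcal{S}(\mathcal{D})$ and a cycle $\gamma$ of $\mathcal{D}$, $\lambda_S(\gamma)$ is the spectral radius (Perron root) of the weighted adjacency matrix of $\gamma$ weighted by $S$; it equals $S(\gamma)^{1/\ell(\gamma)}$, where $S(\gamma)$ is the product of the weights of the arcs of $\gamma$.
   Formalization: The digraph is assumed to have countably many vertices: a strong digraph with uncountably many has no substochastic weighting, so the left side holds vacuously, and the claim fails for the complete digraph on an uncountable set. *)

(* Defs.v *)
(* MathComp-Analysis, with complex numbers from real-closed. *)
From HB Require Import structures.
From mathcomp Require Import all_boot all_order all_algebra.
From mathcomp Require Import finmap complex.
From mathcomp Require Import all_classical all_reals all_analysis.

Set Implicit Arguments.
Unset Strict Implicit.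
Unset Printing Implicit Defensive.

Import Order.TTheory GRing.Theory Num.Theory.

Local Open Scope classical_set_scope.
Local Open Scope card_scope.
Local Open Scope ring_scope.

(* The vertex set is a subset of an ambient type, so that a digraph, its
   subdigraphs and what remains after deleting vertices all have one type. *)
Record digraph (V : choiceType) := Digraph {
  verts : set V;
  arcs : set (V * V);
  arcs_verts : forall a, arcs a -> verts a.1 /\ verts a.2
}.

Section Digraphs.
Variable V : choiceType.
Implicit Types (D C : digraph V) (X : set V).

Definition dipath D (v w : V) : Prop :=
  exists p : seq V,
    [/\ path (fun x y => (x, y) \in arcs D) v p, last v p = w & uniq (v :: p)].

(* The second clause only matters for a one-vertex digraph, which must have
   a loop; in a strong digraph with more vertices it follows from the first. *)
Definition strong D : Prop :=
  (forall v w, verts D v -> verts D w -> v <> w -> dipath D v w) /\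
  (forall v, verts D v -> exists w, arcs D (v, w)).

Definition subdigraph C D : Prop :=
  verts C `<=` verts D /\ arcs C `<=` arcs D.

(* Nonemptiness excludes the empty digraph, which satisfies the other
   clauses vacuously. *)
Definition is_cycle C : Prop :=
  [/\ finite_set (verts C), verts C !=set0, strong C &
      forall v, verts C v -> exists! w, arcs C (v, w)].

Definition cycle_of D C : Prop := subdigraph C D /\ is_cycle C.

(* Meaningful only when there are finitely many arcs: fset_set sends
   infinite sets to fset0. *)
Definition cycle_length C : nat := (#|` fset_set (arcs C)|)%fset.

(* The second clause says that the length of C is less than |A(D)|, where
   A(D) may be infinite. *)
Definition proper_cycle_of D C : Prop :=
  cycle_of D C /\ ~ (arcs D #<= `I_(cycle_length C)).

Lemma delete_subproof D X (a : V * V) :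
  [set a | arcs D a /\ ~ X a.1 /\ ~ X a.2] a ->
  (verts D `\` X) a.1 /\ (verts D `\` X) a.2.
Proof. by move=> [/arcs_verts [? ?] [? ?]]. Qed.

Definition delete D X : digraph V := Digraph (@delete_subproof D X).

Definition cycle_transversal D X : Prop :=
  X `<=` verts D /\ forall C, ~ cycle_of (delete D X) C.

End Digraphs.

Section Weightings.
Variables (R : realType) (V : choiceType).
Implicit Types (D C : digraph V) (S : V * V -> R).

(* Values of S outside the arcs of D are irrelevant. *)
Definition weighting D S : Prop := forall a, arcs D a -> 0 < S a.

(* A possibly infinite sum of positive terms. It is +oo when uncountably many
   arcs leave v, so a strong digraph with uncountably many vertices has no
   substochastic weighting. *)
Definition out_weight D S (v : V) : \bar R :=
  (\esum_(a in [set a | arcs D a /\ a.1 = v]) (S a)%:E)%E.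

Definition substochastic D S : Prop :=
  weighting D S /\ forall v, verts D v -> (out_weight D S v <= 1)%E.

(* The rows and columns are indexed by an enumeration of the vertices, which
   must be finite in number. *)
Definition weighted_adjacency C S : 'M[R]_#|{: fset_set (verts C)}| :=
  \matrix_(i, j)
    let a := (val (enum_val i), val (enum_val j)) in
    if a \in arcs C then S a else 0.

Definition spectral_radius n (M : 'M[R]_n) : R :=
  sup [set ComplexField.Normc.normc z |
        z in [set z : R[i] | eigenvalue (map_mx (real_complex R) M) z]].

Definition cycle_radius C S : R := spectral_radius (weighted_adjacency C S).

(* Taken in the extended reals: the infimum is +oo when D has no proper cycle,
   which happens when D is itself a cycle. *)
Definition inf_cycle_deficit D S : \bar R :=
  ereal_inf [set ((cycle_length C)%:R * (1 - cycle_radius C S))%:E |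
              C in proper_cycle_of D].

End Weightings.

(* Main.v *)
(** A cycle has l(1 - lambda) >= 1 - lambda^l >= 1 - S(a) for each of its arcs a,
    by Bernoulli's inequality and because lambda^l is the product of the weights.
    Two different cycles through a vertex x diverge somewhere, along arcs whose
    weights have sum at most 1, so at most one cycle through x has
    l(1 - lambda) < 1/2; a proper cycle has an arc of weight less than 1, since
    otherwise it would absorb the whole digraph. A finite transversal therefore
    gives a positive lower bound, the least of finitely many.

    Without a finite transversal there are infinitely many disjoint cycles C_n.
    Giving the arcs of C_n weight 1 - e_n leaves an amount e_n at each of its
    vertices, which is spread over the other, countably many, outgoing arcs. Then
    l(1 - lambda) = l(C_n) e_n on C_n, and e_n can be chosen to make this tend
    to 0. *)

Require Import Defs.
From HB Require Import structures.
From mathcomp Require Import all_boot all_order all_algebra.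
From mathcomp Require Import fingroup perm finmap complex.
From mathcomp Require Import all_classical all_reals all_analysis.
From mathcomp Require Import ring lra.

Set Implicit Arguments.
Unset Strict Implicit.
Unset Printing Implicit Defensive.

Import Order.TTheory GRing.Theory Num.Theory.

Local Open Scope classical_set_scope.
Local Open Scope card_scope.
Local Open Scope ring_scope.

(** * Out-weights and substochastic weightings *)

(** An [esum] is the supremum of its finite partial sums, and an arc leaving [v] is determined by
    its head. *)
Lemma out_weight_le (R : realType) (V : choiceType) (D : digraph V)
    (S : V * V -> R) v (b : R) :
  (out_weight D S v <= b%:E)%E <->
  (forall s : seq V, uniq s -> (forall w, w \in s -> arcs D (v, w)) ->
     \sum_(w <- s) S (v, w) <= b).
Proof.
split=> [leb s us sD | leb].
  have ui : uniq [seq (v, w) | w <- s] by rewrite map_inj_uniq // => ? ? [].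
  rewrite -lee_fin; apply: le_trans leb; apply: esum_ge.
  exists [set` [seq (v, w) | w <- s]].
    by split=> [|a /= /mapP[w /sD ? ->]]; [exact: finite_seq|].
  by rewrite -fsbig_seq // sumEFin lee_fin big_map.
apply: ge_ereal_sup => _ [F [finF FD] <-].
rewrite fsbig_finite //= sumEFin lee_fin.
have FvE a : a \in fset_set F -> a = (v, a.2).
  by rewrite in_fset_set // inE => /FD [_ <-]; case: a.
rewrite (eq_big_seq (fun a => S (v, a.2))) => [|a /FvE <- //].
rewrite -(big_map snd predT (fun w => S (v, w))); apply: leb.
  rewrite map_inj_in_uniq ?fset_uniq // => a a' /FvE -> /FvE -> /=.
  by move=> ->.
move=> w /mapP[a aF ->]; rewrite -FvE //.
by move: aF; rewrite in_fset_set // inE => /FD [].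
Qed.

Section Substochastic.
Variables (R : realType) (V : choiceType) (D : digraph V) (S : V * V -> R).
Hypothesis substoS : substochastic D S.

Lemma substochastic_le1 v w : arcs D (v, w) -> S (v, w) <= 1.
Proof.
move=> Dvw; have [vD _] := arcs_verts Dvw.
have /out_weight_le/(_ [:: w] isT) := substoS.2 _ vD.
by rewrite big_seq1; apply=> u; rewrite inE => /eqP ->.
Qed.

Lemma substochastic_add_le1 v w u : arcs D (v, w) -> arcs D (v, u) -> w <> u ->
  S (v, w) + S (v, u) <= 1.
Proof.
move=> Dvw Dvu wu; have [vD _] := arcs_verts Dvw.
have /out_weight_le/(_ [:: w; u]) := substoS.2 _ vD.
rewrite big_cons big_seq1; apply; first by rewrite /= inE andbT; apply/eqP.
by move=> x; rewrite !inE => /orP[] /eqP ->.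
Qed.

End Substochastic.

(** * Bernoulli's inequality and the complex modulus *)

(** By induction: each step multiplies the gap between the two sides by [r] and adds
    [n (1 - r)^2]. *)
Lemma expr_ge_bernoulli (R : realDomainType) (r : R) n :
  0 <= r -> 1 - r ^+ n <= n%:R * (1 - r).
Proof.
move=> r0; elim: n => [|n IH]; first by rewrite expr0 subrr mul0r.
have -> : 1 - r ^+ n.+1 = 1 - r + r * (1 - r ^+ n) by rewrite exprS; ring.
have -> : n.+1%:R * (1 - r) = 1 - r + r * (n%:R * (1 - r))
    + n%:R * (1 - r) ^+ 2 by rewrite -addn1 natrD; ring.
rewrite -[leRHS]addrA lerD2l ler_wpDr ?ler_wpM2l //.
by rewrite mulr_ge0 ?ler0n ?sqr_ge0.
Qed.

Local Notation normc := ComplexField.Normc.normc.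

Lemma normc_ge0 (R : realType) (z : R[i]) : 0 <= normc z.
Proof. by case: z => x y; exact: sqrtr_ge0. Qed.

Lemma normcX (R : realType) (z : R[i]) k : normc (z ^+ k) = normc z ^+ k.
Proof.
elim: k => [|k IH]; first by rewrite !expr0 ComplexField.Normc.normc1.
by rewrite !exprS ComplexField.Normc.normcM IH.
Qed.

Lemma normc_real (R : realType) (x : R) : 0 <= x -> normc (real_complex R x) = x.
Proof. by move=> x0; rewrite /= expr0n /= addr0 sqrtr_sqr ger0_norm. Qed.

(** * Propagation along the arcs of a strong digraph *)

Section Strong.
Variables (V : choiceType) (D : digraph V).
Hypothesis Dstrong : strong D.

Lemma strong_closed (P : set V) x : verts D x -> P x ->
  (forall v w, arcs D (v, w) -> P v -> P w) -> verts D `<=` P.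
Proof.
move=> xD Px Pclosed y yD.
have [<- //|xy] := pselect (x = y).
have [p [pp <- _]] := Dstrong.1 _ _ xD yD xy.
elim: p x Px pp {xD xy} => [|w p IH] x Px //= /andP[/set_mem xw].
exact/IH/(Pclosed x).
Qed.

(** Agreement puts every arc of [D] that leaves a vertex of [C] into [C], so the vertices of [C] are
    closed under the arcs of [D] and [C] absorbs [D]. *)
Lemma strong_arcs_sub (C : digraph V) x :
  (forall v, verts C v -> exists w, arcs C (v, w)) -> verts D x -> verts C x ->
  (forall v w u, arcs D (v, w) -> arcs C (v, u) -> w = u) ->
  arcs D `<=` arcs C.
Proof.
move=> Cout xD xC agree.
have DC v w : arcs D (v, w) -> verts C v -> arcs C (v, w).
  by move=> vw /Cout [u vu]; rewrite (agree _ _ _ vw vu).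
move=> [v w] vw; apply: (DC) => //; have [/= vD _] := arcs_verts vw.
apply: (strong_closed xD xC) vD => v' w' vw' /(DC _ _ vw').
by move=> /arcs_verts[].
Qed.

End Strong.

(** * The structure of a directed cycle *)

Section Cycle.
Variables (V : choiceType) (C : digraph V).
Hypothesis cycC : is_cycle C.

Local Notation T := {: fset_set (verts C)}.
Local Notation n := #|T|.

Let finC : finite_set (verts C). Proof. by case: cycC. Qed.

(** The numbering that indexes the rows and columns of [weighted_adjacency]. *)
Let vtx (i : 'I_n) : V := val (enum_val i).

Let vtxP i : verts C (vtx i).
Proof. by have := valP (enum_val i); rewrite in_fset_set // inE. Qed.

Let vtx_surj v : verts C v -> exists i, vtx i = v.
Proof.
move=> vC; have vF : v \in fset_set (verts C) by rewrite in_fset_set // inE.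
by exists (enum_rank [` vF]%fset); rewrite /vtx enum_rankK.
Qed.

Let vtx_inj : injective vtx.
Proof. by move=> i j /val_inj/enum_val_inj. Qed.

Lemma cycle_arc_uniq v w u : arcs C (v, w) -> arcs C (v, u) -> w = u.
Proof.
move=> vw vu; have [/= vC _] := arcs_verts vw.
by have [_ _ _ /(_ _ vC) [x [_ ux]]] := cycC; rewrite -(ux _ vw) -(ux _ vu).
Qed.

Lemma cycle_out v : verts C v -> exists w, arcs C (v, w).
Proof. by move=> vC; have [_ _ _ /(_ _ vC) [w [? _]]] := cycC; exists w. Qed.

(** The last arc of a path back to [w] from its successor enters [w], unless the successor is [w]
    itself and the arc a loop. *)
Lemma cycle_in w : verts C w -> exists v, arcs C (v, w).
Proof.
move=> wC; have [x wx] := cycle_out wC.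
have [_ xC] := arcs_verts wx; have [xw|xw] := pselect (x = w).
  by exists w; rewrite -{2}xw.
have [_ _ [+ _] _] := cycC => /(_ _ _ xC wC xw) [p []].
elim/last_ind: p => [//= _ /xw //|p y _].
by rewrite rcons_path last_rcons => /andP[_ /set_mem ?] <- _; exists (last x p).
Qed.

(** Predecessors are chosen first: since one arc leaves each vertex, the choice is injective, hence
    a permutation, and [s] is its inverse. *)
Lemma cycle_perm : exists s : {perm 'I_n},
  forall i j, arcs C (vtx i, vtx j) <-> s i = j.
Proof.
have ex_pred i : exists j, arcs C (vtx j, vtx i).
  have [v vi] := cycle_in (vtxP i).
  by have [/= /vtx_surj[j jv] _] := arcs_verts vi; exists j; rewrite jv.
have [f fP] := choice ex_pred.
have f_inj : injective f.
  by move=> i j fij; apply/vtx_inj/(@cycle_arc_uniq (vtx (f i))); rewrite // fij.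
exists (perm f_inj)^-1%g => i j; split=> [ij|<-].
  apply: (@perm_inj _ (perm f_inj)); rewrite permKV permE.
  have [k ik] : exists k, i = f k.
    by exists ((perm f_inj)^-1%g i); rewrite -(permE f_inj) permKV.
  rewrite {1}ik; congr (f _); apply: vtx_inj; apply: cycle_arc_uniq ij.
  by rewrite ik; exact: fP.
by have := fP ((perm f_inj)^-1%g i); rewrite -(permE f_inj) permKV.
Qed.

Lemma cycle_arcs_finite : finite_set (arcs C).
Proof.
apply: (sub_finite_set _ (finite_setX finC finC)) => a /arcs_verts [? ?].
by split.
Qed.

(** Sending an arc to its tail is a bijection onto the vertices. *)
Lemma cycle_length_card : cycle_length C = n.
Proof.
have -> : verts C = [set a.1 | a in arcs C].
  apply/seteqP; split=> [v /cycle_out [w vw]|_ [a /arcs_verts [? _] <-] //].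
  by exists (v, w).
rewrite -cardfE fset_set_image; last exact: cycle_arcs_finite.
rewrite card_in_imfset //= => -[v w] [v' w'].
rewrite !in_fset_set ?inE /=; try exact: cycle_arcs_finite.
by move=> vw vw' /= vv; move: vw'; rewrite -vv => /(cycle_arc_uniq vw) ->.
Qed.

Lemma cycle_card_gt0 : (0 < n)%N.
Proof.
have [_ [v vC] _ _] := cycC.
by have [i _] := vtx_surj vC; apply: leq_ltn_trans (ltn_ord i).
Qed.

(** * Eigenvalues of a weighted cycle *)

Section Radius.
Variables (R : realType) (S : V * V -> R).
Hypothesis Spos : forall a, arcs C a -> 0 < S a.
Hypothesis Sle1 : forall a, arcs C a -> S a <= 1.

Local Notation M := (map_mx (real_complex R) (weighted_adjacency C S)).

(** In column [s i] only the entry of row [i] can be nonzero. *)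
Lemma mulmx_weighted_adjacency (s : {perm 'I_n}) (u : 'rV[R[i]]_n) i :
  (forall i j, arcs C (vtx i, vtx j) <-> s i = j) ->
  (u *m M) 0 (s i) = u 0 i * real_complex R (S (vtx i, vtx (s i))).
Proof.
move=> sP; rewrite mxE (bigD1 i) //= big1 ?addr0 => [|k ki].
  by rewrite !mxE /= mem_set //; exact/sP.
rewrite !mxE /= memNset ?mulr0 // => /sP /perm_inj ki'.
by rewrite ki' eqxx in ki.
Qed.

(* Along an eigenvector u, z * u (s i) = u i * S (i, s i); multiplying these
   relations around the cycle cancels the entries of u. *)
Lemma eigenvalue_cycle (s : {perm 'I_n}) (z : R[i]) :
  (forall i j, arcs C (vtx i, vtx j) <-> s i = j) ->
  eigenvalue M z -> z != 0 ->
  z ^+ n = real_complex R (\prod_i S (vtx i, vtx (s i))).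
Proof.
move=> sP /eigenvalueP [u uz u0] z0.
have zu i : z * u 0 (s i) = u 0 i * real_complex R (S (vtx i, vtx (s i))).
  by rewrite -mulmx_weighted_adjacency // uz mxE.
have Sn0 i : real_complex R (S (vtx i, vtx (s i))) != 0.
  by rewrite fmorph_eq0 gt_eqF // Spos //; exact/sP.
have us i : u 0 i != 0 -> u 0 (s i) != 0.
  move=> ui; apply/eqP => usi; move: (zu i); rewrite usi mulr0 => /esym/eqP.
  by rewrite mulf_eq0 (negbTE ui) (negbTE (Sn0 i)).
have [i0 ui0] : exists i, u 0 i != 0.
  apply/existsP; rewrite -negb_forall; apply: contra u0 => /forallP u0.
  by apply/eqP/rowP => i; rewrite mxE; apply/eqP.
(* Nonvanishing spreads along the arcs from the entry [i0] to all others, which permits the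
   cancellation. *)
have un0 j : u 0 j != 0.
  have [_ _ Cstrong _] := cycC.
  suff CP : verts C `<=` [set v | forall i, vtx i = v -> u 0 i != 0].
    exact: CP (vtxP j) j erefl.
  apply: (strong_closed Cstrong (vtxP i0)) => [i /vtx_inj -> //|v w vw /= uv k kw].
  have [/= /vtx_surj [l lv] _] := arcs_verts vw.
  have /sP <- : arcs C (vtx l, vtx k) by rewrite lv kw.
  exact/us/uv.
have : \prod_i (z * u 0 (s i)) =
    \prod_i (u 0 i * real_complex R (S (vtx i, vtx (s i)))).
  by apply: eq_bigr.
rewrite !big_split /=.
have -> : \prod_i u 0 i = \prod_i u 0 (s i) by rewrite (reindex_perm s).
rewrite prodr_const card_ord.
rewrite [RHS]mulrC -rmorph_prod => /mulIf; apply.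
by apply/prodf_neq0 => i _; exact: un0.
Qed.

(** Bernoulli reduces this to [normc z ^+ n <= S a]; for [z != 0] the left side is the product of
    all weights, whose other factors are at most 1. *)
Lemma eigenvalue_cycle_deficit (z : R[i]) a : arcs C a -> eigenvalue M z ->
  1 - S a <= n%:R * (1 - normc z).
Proof.
move=> aC zM; apply: le_trans (expr_ge_bernoulli _ (normc_ge0 z)).
rewrite lerB //; have [->|z0] := eqVneq z 0.
  by rewrite ComplexField.Normc.normc0 expr0n gtn_eqF ?cycle_card_gt0 ?ltW ?Spos.
have [s sP] := cycle_perm.
have S01 i : 0 <= S (vtx i, vtx (s i)) <= 1.
  by rewrite ltW ?Spos ?Sle1 //; exact/sP.
have /= [/vtx_surj [i ia] /vtx_surj [j ja]] := arcs_verts aC.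
have aE : a = (vtx i, vtx (s i)).
  have /sP -> : arcs C (vtx i, vtx j) by rewrite ia ja; case: (a) aC.
  by rewrite ia ja; case: (a).
rewrite -normcX (eigenvalue_cycle sP) // normc_real; last first.
  by apply: prodr_ge0 => k _; case/andP: (S01 k).
rewrite (bigD1 i) //= aE ler_piMr //; first by case/andP: (S01 i).
exact: prodr_ile1.
Qed.

(** Solved for [normc z], the estimate is an upper bound common to all eigenvalues, as the supremum
    in [spectral_radius] requires. *)
Lemma eigenvalue_cycle_le (z : R[i]) a : arcs C a -> eigenvalue M z ->
  normc z <= 1 - (1 - S a) / n%:R.
Proof.
move=> aC /(eigenvalue_cycle_deficit aC).
have n0 : 0 < n%:R :> R by rewrite ltr0n cycle_card_gt0.
by rewrite mulrC -ler_pdivrMr // lerBrDr addrC -lerBrDr.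
Qed.

Lemma cycle_deficit_ge a : arcs C a ->
  1 - S a <= (cycle_length C)%:R * (1 - cycle_radius C S).
Proof.
move=> aC; rewrite cycle_length_card.
have n0 : 0 < n%:R :> R by rewrite ltr0n cycle_card_gt0.
rewrite mulrC -ler_pdivrMr // lerBrDr addrC -lerBrDr /cycle_radius.
rewrite /spectral_radius; set E := image _ _.
(* The [sup] of the empty set is 0 by convention; the bound then follows from
   [1 - S a <= 1 <= n]. *)
have [->|/set0P E0] := eqVneq E set0.
  rewrite sup0 subr_ge0 ler_pdivrMr // mul1r.
  apply: (@le_trans _ _ 1); last by rewrite ler1n cycle_card_gt0.
  by rewrite lerBlDr lerDl ltW ?Spos.
by apply: ge_sup => // _ [z zM <-]; exact: eigenvalue_cycle_le.
Qed.

(** The all-ones row vector is an eigenvector for [c]. This bounds the deficit from above on the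
    cycles of the counterexample. *)
Lemma constant_le_cycle_radius (c : R) :
  (forall a, arcs C a -> S a = c) -> c <= cycle_radius C S.
Proof.
move=> Sc; have [s sP] := cycle_perm.
pose i0 := Ordinal cycle_card_gt0.
pose a0 := (vtx i0, vtx (s i0)); have a0C : arcs C a0 by exact/sP.
apply: ub_le_sup.
  exists (1 - (1 - S a0) / n%:R) => _ [z zM <-].
  exact: eigenvalue_cycle_le.
have c0 : 0 <= c by rewrite -(Sc a0) // ltW ?Spos.
exists (real_complex R c); last exact: normc_real.
apply/eigenvalueP; exists (const_mx 1).
  apply/rowP => j; rewrite -(permKV s j) mulmx_weighted_adjacency // Sc; last exact/sP.
  by rewrite !mxE mulrC.
by apply/eqP => /rowP/(_ i0)/eqP; rewrite !mxE oner_eq0.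
Qed.

End Radius.
End Cycle.

(** * A finite transversal bounds the deficits from below *)

Section Transversal.
Variables (R : realType) (V : choiceType) (D : digraph V) (S : V * V -> R).
Hypothesis Dstrong : strong D.
Hypothesis substoS : substochastic D S.

Local Notation deficit C := ((cycle_length C)%:R * (1 - cycle_radius C S)).

(** Cycles that never diverge absorb each other, starting from [x]. *)
Lemma cycle_eq_or_diverge (C C' : digraph V) x :
  is_cycle C -> is_cycle C' -> verts C x -> verts C' x ->
  arcs C = arcs C' \/
  exists v w u, [/\ arcs C (v, w), arcs C' (v, u) & w <> u].
Proof.
move=> cycC cycC' xC xC'; apply: contrapT => /not_orP[CC' nodiv]; apply: CC'.
have agree v w u : arcs C (v, w) -> arcs C' (v, u) -> w = u.
  by move=> vw vu; apply: contrapT => wu; apply: nodiv; exists v, w, u.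
have [_ _ Cs _] := cycC; have [_ _ Cs' _] := cycC'.
apply/seteqP; split.
- by apply: (strong_arcs_sub Cs) xC xC' agree => v; exact: cycle_out.
- apply: (strong_arcs_sub Cs') xC' xC _ => [v|v w u]; first exact: cycle_out.
  by move=> vw vu; rewrite (agree _ _ _ vu vw).
Qed.

Lemma cycle_of_deficit_ge (C : digraph V) a : cycle_of D C -> arcs C a ->
  1 - S a <= deficit C.
Proof.
move=> [[_ CD] cycC]; apply: cycle_deficit_ge => // b /CD.
  exact: substoS.1.
by case: b => v w; exact: substochastic_le1.
Qed.

(** An arc of weight 1 exhausts the out-weight of its tail, so it is the only arc leaving it; a
    cycle of such arcs would contain all arcs of [D]. *)
Lemma proper_cycle_arc_lt1 (C : digraph V) : proper_cycle_of D C ->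
  exists2 a, arcs C a & S a < 1.
Proof.
move=> [[[CVD CD] cycC] proper]; apply: contrapT => nolt; apply: proper.
have S1 v w : arcs C (v, w) -> S (v, w) = 1.
  move=> vw; apply/eqP; rewrite eq_le (substochastic_le1 substoS) /=; last exact: CD.
  by rewrite leNgt; apply/negP => vwlt; apply: nolt; exists (v, w).
suff -> : arcs D = arcs C.
  have finC := cycle_arcs_finite cycC.
  have : [set` fset_set (arcs C)] #= `I_(cycle_length C) by exact/card_eq_fsetP.
  by rewrite fset_setK // card_eq_le => /andP[].
apply/seteqP; split=> //.
have [_ [x xC] _ _] := cycC.
apply: (strong_arcs_sub Dstrong) (CVD _ xC) xC _ => [v|v w u vw vu].
  exact: cycle_out.
apply: contrapT => wu.
have := substochastic_add_le1 substoS vw (CD _ vu) wu.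
by rewrite (S1 _ _ vu) gerDr leNgt substoS.1.
Qed.

(** The bound is the deficit of the one cycle through [x] with deficit below 1/2, if there is one,
    and 1/2 otherwise. *)
Lemma deficit_ge_at_vertex x : exists2 d : R, 0 < d &
  forall C, proper_cycle_of D C -> verts C x -> d <= deficit C.
Proof.
have [|nosmall] := pselect (exists C,
    [/\ proper_cycle_of D C, verts C x & deficit C < 2^-1]).
  move=> [C [pC xC smallC]]; exists (deficit C).
    have [a aC Sa1] := proper_cycle_arc_lt1 pC.
    by apply: lt_le_trans (cycle_of_deficit_ge pC.1 aC); rewrite subr_gt0.
  move=> C' pC' xC'; have [[CD cycC] _] := pC; have [[CD' cycC'] _] := pC'.
  have [CC'|[v [w [u [vw vu wu]]]]] := cycle_eq_or_diverge cycC cycC' xC xC'.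
    have VCC' : verts C = verts C'.
      apply/seteqP; split=> v /cycle_out [] // w.
        by rewrite CC' => /arcs_verts[].
      by rewrite -CC' => /arcs_verts[].
    suff -> : C = C' by [].
    case: (C) (C') CC' VCC' => [? ? h] [? ? h'] /= ? ?; subst.
    by rewrite (Prop_irrelevance h h').
  (* As [C] has deficit below 1/2, [(v, w)] weighs more than 1/2 and [(v, u)] less, so [C'] has
     deficit above 1/2. *)
  have := substochastic_add_le1 substoS (CD.2 _ vw) (CD'.2 _ vu) wu.
  have := cycle_of_deficit_ge pC.1 vw; have := cycle_of_deficit_ge pC'.1 vu.
  by lra.
exists 2^-1 => [|C pC xC]; first by rewrite invr_gt0.
by rewrite leNgt; apply/negP => ?; apply: nosmall; exists C.
Qed.

Lemma deficit_ge_at_vertices (s : seq V) : exists2 d : R, 0 < d &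
  forall C x, proper_cycle_of D C -> x \in s -> verts C x -> d <= deficit C.
Proof.
elim: s => [|x s [d d0 dP]]; first by exists 1.
have [e e0 eP] := deficit_ge_at_vertex x.
exists (Num.min d e) => [|C y pC]; first by rewrite lt_min d0.
rewrite inE ge_min => /orP[/eqP ->|ys] yC; apply/orP; [right|left].
  exact: eP.
exact: dP pC ys yC.
Qed.

Lemma inf_cycle_deficit_gt0 (X : set V) : finite_set X ->
  cycle_transversal D X -> (0 < inf_cycle_deficit D S)%E.
Proof.
move=> /finite_seqP [s ->] [_ sP].
have [d d0 dP] := deficit_ge_at_vertices s.
apply: (@lt_le_trans _ _ d%:E); first by rewrite lte_fin.
apply: le_ereal_inf_tmp => _ [C pC <-]; rewrite lee_fin.
have [[[CVD CD] cycC] _] := pC.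
(* A cycle avoiding [s] would survive the deletion of the transversal. *)
suff [x xs xC] : exists2 x, x \in s & verts C x by exact: dP xs xC.
apply: contrapT => sC; apply: (sP C); split=> //.
have CVs x : verts C x -> ~ x \in s by move=> xC xs; apply: sC; exists x.
split=> [x xC|a aC]; split; [exact: CVD|exact: CVs|exact: CD|].
by have [? ?] := arcs_verts aC; split; exact: CVs.
Qed.

End Transversal.

(** * Disjoint cycles in the absence of a finite transversal *)

(** Greedy choice: the vertices of the cycles found so far form a finite set, which is no
    transversal, so a cycle survives their deletion. *)
Lemma disjoint_cycles (V : choiceType) (D : digraph V) :
  ~ (exists X : set V, finite_set X /\ cycle_transversal D X) ->
  exists C : nat -> digraph V, (forall n, cycle_of D (C n)) /\
    forall m n v, verts (C m) v -> verts (C n) v -> m = n.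
Proof.
move=> notrans.
have next X : exists C, finite_set X /\ X `<=` verts D ->
    cycle_of (delete D X) C.
  have [[finX XD]|] := pselect (finite_set X /\ X `<=` verts D); last by exists D.
  apply: contrapT => noC; apply: notrans; exists X; split=> //; split=> // C CX.
  by apply: noC; exists C.
have [f fP] := choice next.
(* [X n] collects the vertices of the first [n] cycles. *)
pose X n := iter n (fun X => X `|` verts (f X)) set0.
have XP n : finite_set (X n) /\ X n `<=` verts D.
  elim: n => [|n [finX XD]]; first by split=> [|? []]; exact: finite_set0.
  have [[+ _] [finf _ _ _]] := fP _ (conj finX XD) => /= fD.
  by split; [rewrite /= finite_setU|rewrite subUset; split=> // v /fD []].
exists (fun n => f (X n)); split=> [n|].
  have [[CV CA] cycC] := fP _ (XP n); split=> //.
  by split=> [v /CV []|a /CA []].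
have lt_disj m n v : (m < n)%N -> verts (f (X m)) v -> verts (f (X n)) v -> False.
  move=> mn mv nv; have [[/(_ _ nv) [_ + _] _]] := fP _ (XP n); apply.
  elim: n mn {nv} => // n IH; rewrite ltnS leq_eqVlt => /orP[/eqP <-|/IH ?].
    by right.
  by left.
move=> m n v mv nv; case: (ltngtP m n) => // mn.
  by case: (lt_disj _ _ _ mn mv nv).
by case: (lt_disj _ _ _ mn nv mv).
Qed.

(** These are the proportions in which a vertex spreads its spare out-weight; the exponent [k.+1]
    makes the whole series sum to 1. *)
Lemma sum_half_powers_le1 (R : realFieldType) (s : seq nat) : uniq s ->
  \sum_(k <- s) 2^-1 ^+ k.+1 <= 1 :> R.
Proof.
move=> us; pose N := (\max_(k <- s) k).+1.
have ps : perm_eq s [seq k <- index_iota 0 N | k \in s].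
  apply: uniq_perm; rewrite ?filter_uniq ?iota_uniq // => k.
  rewrite mem_filter mem_index_iota /= ltnS; case ks: (k \in s) => //=.
  by rewrite leq_bigmax_seq.
rewrite (perm_big _ ps) big_filter.
apply: (@le_trans _ _ (\sum_(0 <= k < N) 2^-1 ^+ k.+1)).
  by rewrite big_mkcond; apply: ler_sum => k _; case: ifP.
have -> : \sum_(0 <= k < N) 2^-1 ^+ k.+1 = 1 - 2^-1 ^+ N :> R.
  elim: N {ps} => [|N IH]; first by rewrite big_nil expr0 subrr.
  by rewrite big_nat_recr //= IH exprS; lra.
by rewrite gerBl exprn_ge0 // invr_ge0.
Qed.

(** * A weighting whose infimum is not positive *)

Section DisjointCycles.
Variables (R : realType) (V : choiceType) (D : digraph V).
Variable C : nat -> digraph V.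
Hypothesis Dcountable : countable (verts D).
Hypothesis CD : forall n, cycle_of D (C n).
Hypothesis C_disj : forall m n v, verts (C m) v -> verts (C n) v -> m = n.

(** Otherwise [C n] would contain all arcs of [D], among them those of the disjoint cycle
    [C n.+1]. *)
Lemma disjoint_cycle_proper n : proper_cycle_of D (C n).
Proof.
split=> // Dle; have [[_ CDn] cycn] := CD n.
have finC := cycle_arcs_finite cycn.
have finD : finite_set (arcs D) by exact: card_le_finite Dle (finite_II _).
have CeqD : arcs (C n) = arcs D.
  apply: (fset_set_inj finC finD).
  apply/eqP; rewrite eqEfcard; apply/andP; split; last exact: geq_card_fset_set.
  by rewrite -fset_set_sub.
have [[_ CDm] cycm] := CD n.+1; have [_ [v vm] _ _] := cycm.
have [w vw] := cycle_out cycm vm.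
have := CDm _ vw; rewrite -CeqD => /arcs_verts [vn _].
by have := C_disj vn vm => /eqP; rewrite ltn_eqF.
Qed.

Lemma disjoint_cycles_weighting (e : nat -> R) : (forall n, 0 < e n < 1) ->
  exists2 S : V * V -> R, substochastic D S &
    forall n a, arcs (C n) a -> S a = 1 - e n.
Proof.
move=> e01; have /countable_injP [idx idx_inj] := Dcountable.
(* The spare out-weight at [v], well defined by disjointness; off the cycles 1/2 is an arbitrary
   value in the open unit interval. *)
have ex_eps v : exists x : R, 0 < x < 1 /\ forall n, verts (C n) v -> x = e n.
  have [[n vn]|no] := pselect (exists n, verts (C n) v).
    by exists (e n); split=> // m vm; rewrite (C_disj vn vm).
  exists 2^-1; split=> [|n vn]; first by apply/andP; split; lra.
  by case: no; exists n.
have [eps epsP] := choice ex_eps.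
pose U := \bigcup_n arcs (C n).
pose F a := eps a.1 * 2^-1 ^+ (idx a.2).+1.
pose S a := if a \in U then 1 - eps a.1 else F a.
have eps_gt0 v : 0 < eps v by have [/andP[]] := epsP v.
have eps_lt1 v : eps v < 1 by have [/andP[]] := epsP v.
have F_gt0 a : 0 < F a by rewrite mulr_gt0 ?exprn_gt0 ?invr_gt0.
have UP v w u : U (v, w) -> U (v, u) -> w = u.
  move=> [m _ vw] [n _ vu]; have [/= vm _] := arcs_verts vw.
  have [/= vn _] := arcs_verts vu.
  rewrite (C_disj vm vn) in vw; exact: cycle_arc_uniq (CD n).2 _ _ _ vw vu.
exists S; last first.
  move=> n a an; have [va _] := arcs_verts an.
  by rewrite /S mem_set; [rewrite ((epsP _).2 _ va)|exists n].
split=> [a _|v vD]; first by rewrite /S; case: ifP; rewrite ?subr_gt0.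
apply/out_weight_le => s us sD.
(* Distinct heads have distinct indices [idx], so the geometric bound applies. *)
have sumF (P : pred V) : \sum_(w <- s | P w) F (v, w) <= eps v.
  apply: (@le_trans _ _ (\sum_(w <- s) F (v, w))).
    rewrite big_mkcond; apply: ler_sum => w _; case: ifP => // _; exact: ltW.
  rewrite /F /= -mulr_sumr ler_piMr ?(ltW (eps_gt0 _)) //.
  rewrite -(big_map idx predT (fun k => 2^-1 ^+ k.+1)) sum_half_powers_le1 //.
  rewrite map_inj_in_uniq // => w u ws uw; apply: idx_inj; rewrite inE.
    by have [] := arcs_verts (sD _ ws).
  by have [] := arcs_verts (sD _ uw).
(* By [UP] at most one arc in the sum lies on a cycle: it takes [1 - eps v], the others at most
   [eps v] together. *)
have [/hasP [w ws /set_mem vwU]|noU] := boolP (has (fun w => (v, w) \in U) s).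
  rewrite (bigD1_seq w) //= {1}/S mem_set //=.
  rewrite (eq_bigr (fun u => F (v, u))) => [|u uw].
    by have := sumF (fun u => u != w); lra.
  by rewrite /S memNset // => /(UP _ _ _ vwU) wu; rewrite wu eqxx in uw.
rewrite (eq_big_seq (fun u => F (v, u))) => [|u /(hasPn noU) vu].
  by apply: le_trans (sumF predT) (ltW _).
by rewrite /S (negbTE vu).
Qed.

Lemma disjoint_cycles_deficit0 : exists2 S : V * V -> R,
  substochastic D S & (inf_cycle_deficit D S <= 0)%E.
Proof.
(* Chosen so that length times [e n] is at most [1 / (n + 1)]; the [.+2] ensures [e n < 1] even at
   [n = 0], whatever the length. *)
pose e n : R := (n.+1%:R * (cycle_length (C n)).+2%:R)^-1.
have e01 n : 0 < e n < 1.
  rewrite invr_gt0 mulr_gt0 //= invf_lt1 ?mulr_gt0 //.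
  by rewrite -natrM ltr1n mulSn ltn_addr.
have [S substoS SC] := disjoint_cycles_weighting e01.
exists S => //; rewrite leNgt; apply/negP => inf_gt0.
have inf_le n : (inf_cycle_deficit D S <= (n.+1%:R^-1)%:E)%E.
  have Cn := disjoint_cycle_proper n.
  apply: (@le_trans _ _ ((cycle_length (C n))%:R * (1 - cycle_radius (C n) S))%:E).
    by apply: ereal_inf_lbound; exists (C n).
  have [[_ CDn] cycn] := CD n.
  have rad : 1 - e n <= cycle_radius (C n) S.
    apply: constant_le_cycle_radius => // [a|a aC|a aC]; last exact: SC.
      by move=> /CDn; exact: substoS.1.
    by rewrite (SC _ _ aC) gerBl; case/andP: (e01 n) => /ltW.
  rewrite lee_fin.
  have [e_gt0 _] := andP (e01 n).
  apply: (@le_trans _ _ ((cycle_length (C n)).+2%:R * e n)).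
    apply: (@le_trans _ _ ((cycle_length (C n))%:R * e n)).
      by rewrite ler_wpM2l //; lra.
    by rewrite ler_wpM2r ?ler_nat ?leqW // ltW.
  by rewrite /e invfM mulrCA divff ?mulr1.
(* Positive and at most 1, the infimum is a real number, to which the Archimedean property
   applies. *)
have [r rE] : exists r, inf_cycle_deficit D S = r%:E.
  move: inf_gt0 (inf_le 0%N).
  by case: (inf_cycle_deficit D S) => // r _ _; exists r.
move: inf_gt0 inf_le; rewrite rE lte_fin => r0 rle.
have [n] := ltr_add_invr r0.
by rewrite add0r ltNge; move: (rle n); rewrite lee_fin => ->.
Qed.

End DisjointCycles.

(** Countability lets the spare out-weight be spread over all arcs. A strong digraph with
    uncountably many vertices has no substochastic weighting, so the left side would hold
    vacuously. *)
Theorem proposition1 (R : realType) (V : choiceType) (D : digraph V)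
    (Dcountable : countable (verts D)) (Dstrong : strong D) :
  (forall S : V * V -> R, substochastic D S -> (0 < inf_cycle_deficit D S)%E)
  <-> (exists X : set V, finite_set X /\ cycle_transversal D X).
Proof.
split=> [infP|[X [finX sctX]] S substoS]; last first.
  exact: inf_cycle_deficit_gt0 finX sctX.
apply: contrapT => /disjoint_cycles [C [CD C_disj]].
have [S substoS] := disjoint_cycles_deficit0 R Dcountable CD C_disj.
by rewrite leNgt infP.
Qed.
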